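(* Let $(M,g)$ be a smooth, compact, connected Riemannian manifold. Then the group $\mathrm{Iso}(M,g)$ of smooth isometries is $C^0$-closed within the group $\mathrm{Diff}^{\infty}(M)$ of smooth diffeomorphisms of $M$; that is, if $\psi\in\mathrm{Diff}^{\infty}(M)$ is the $C^0$-limit of a sequence of elements of $\mathrm{Iso}(M,g)$, then $\psi\in\mathrm{Iso}(M,g)$.
   Context: $\mathrm{Iso}(M,g)=\{\phi\in\mathrm{Diff}^{\infty}(M):\phi^*g=g\}$. A sequence $\psi_i$ converges to $\psi$ in $C^0$ if $\sup_{x\in M} d_g(\psi_i(x),\psi(x))\to 0$, where $d_g$ is the Riemannian distance. *)

(* Defs.v *)
From HB Require Import structures.
From mathcomp Require Import all_boot all_order all_algebra.
From mathcomp Require Import all_classical all_reals all_analysis.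
Set Implicit Arguments.
Unset Strict Implicit.
Unset Printing Implicit Defensive.
Import Order.TTheory GRing.Theory Num.Theory.
Import numFieldNormedType.Exports.
Local Open Scope classical_set_scope.
Local Open Scope ring_scope.

(* f is of class C^k at the points of U; only meant for U open, since
   derivatives are taken in the whole space V. *)
Fixpoint Ck_on (R : realType) (V W : normedModType R) (k : nat)
    (U : set V) (f : V -> W) : Prop :=
  if k is k'.+1 then
    (forall x, U x -> differentiable f x) /\
    (forall v : V, Ck_on k' U (fun x => 'D_v f x))
  else forall x, U x -> {for x, continuous f}.

Definition smooth_on (R : realType) (V W : normedModType R)
    (U : set V) (f : V -> W) : Prop :=
  forall k, Ck_on k U f.

(* Charts are homeomorphisms between an open set of M and an open set of R^n.
   Both directions are total functions, whose values outside [cdom] and [ccod]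
   are irrelevant. *)
Record chart (R : realType) (n : nat) (M : topologicalType) := Chart {
  cdom : set M ;
  ccod : set 'rV[R]_n ;
  cmap : M -> 'rV[R]_n ;
  cinv : 'rV[R]_n -> M ;
  cdom_open : open cdom ;
  ccod_open : open ccod ;
  cmap_cod : forall p, cdom p -> ccod (cmap p) ;
  cinv_dom : forall x, ccod x -> cdom (cinv x) ;
  cmapK : forall p, cdom p -> cinv (cmap p) = p ;
  cinvK : forall x, ccod x -> cmap (cinv x) = x ;
  cmap_continuous : forall p, cdom p -> {for p, continuous cmap} ;
  cinv_continuous : forall x, ccod x -> {for x, continuous cinv}
}.

(* Smooth manifolds without boundary, of dimension n. The atlas is not required
   to be maximal: the notions defined below do not change when compatible
   charts are added. [chart_at p] is a preferred chart around p. *)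
Record smooth_manifold (R : realType) (n : nat) := SmoothManifold {
  carrier :> topologicalType ;
  carrier_hausdorff : hausdorff_space carrier ;
  carrier_second_countable : @second_countable carrier ;
  atlas_index : Type ;
  atlas : atlas_index -> chart R n carrier ;
  chart_at : carrier -> atlas_index ;
  chart_atP : forall p, cdom (atlas (chart_at p)) p ;
  transition_smooth : forall i j,
    smooth_on (ccod (atlas i) `&` cinv (atlas i) @^-1` cdom (atlas j))
              (cmap (atlas j) \o cinv (atlas i))
}.

Section Maps.
Variables (R : realType) (n : nat) (M : smooth_manifold R n).

Definition local_expr (phi : M -> M) (i j : atlas_index M) :
    'rV[R]_n -> 'rV[R]_n :=
  cmap (atlas j) \o phi \o cinv (atlas i).

Definition smooth_map (phi : M -> M) : Prop :=
  continuous phi /\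
  forall i j : atlas_index M,
    smooth_on (ccod (atlas i) `&` (phi \o cinv (atlas i)) @^-1` cdom (atlas j))
              (local_expr phi i j).

Definition Diff : set (M -> M) :=
  [set phi | smooth_map phi /\
     exists phi' : M -> M,
       [/\ smooth_map phi', cancel phi phi' & cancel phi' phi]].

End Maps.
Arguments Diff {R n} M.

(* A Riemannian metric, given by its Gram matrices in the charts of the atlas.
   Tangent vectors in coordinates are row vectors, so that
   'd f x v = v *m 'J f x, and g(u, v) is the entry of u *m G *m v^T. *)
Record riemannian_metric (R : realType) (n : nat) (M : smooth_manifold R n) :=
  RiemannianMetric {
    gram :> atlas_index M -> 'rV[R]_n -> 'M[R]_n ;
    gram_smooth : forall i, smooth_on (ccod (atlas i)) (gram i) ;
    gram_sym : forall i x, ccod (atlas i) x -> (gram i x)^T = gram i x ;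
    gram_posdef : forall i x, ccod (atlas i) x ->
      forall v : 'rV[R]_n, v != 0 -> 0 < (v *m gram i x *m v^T) 0 0 ;
    gram_transition : forall (i j : atlas_index M) (x : 'rV[R]_n),
      ccod (atlas i) x -> cdom (atlas j) (cinv (atlas i) x) ->
      let T := cmap (atlas j) \o cinv (atlas i) in
      gram i x = 'J T x *m gram j (T x) *m ('J T x)^T
  }.

Section Riemannian.
Variables (R : realType) (n : nat) (M : smooth_manifold R n).
Variable g : riemannian_metric M.

(* Coordinates of phi^* g in the chart i; by [gram_transition] any chart
   around phi p could replace [chart_at (phi p)]. *)
Definition pullback (phi : M -> M) (i : atlas_index M) (x : 'rV[R]_n) :
    'M[R]_n :=
  let j := chart_at (phi (cinv (atlas i) x)) in
  let F := local_expr phi i j in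
  'J F x *m g j (F x) *m ('J F x)^T.

Definition Iso : set (M -> M) :=
  [set phi | Diff M phi /\
     forall i x, ccod (atlas i) x -> pullback phi i x = g i x].

(* Only meant for D open. *)
Definition C1_curve (D : set R) (c : R -> M) : Prop :=
  forall t, D t ->
    {for t, continuous c} /\
    forall i : atlas_index M, cdom (atlas i) (c t) ->
      derivable (cmap (atlas i) \o c) t 1 /\
      {for t, continuous ((cmap (atlas i) \o c)^`())%classic}.

(* c is C^1 on each closed piece [u, v] of a partition, in the sense that it
   coincides there with a C^1 curve defined on a larger open interval.
   Consecutive pieces share their endpoints, so c is continuous on [a, b]. *)
Definition piecewise_C1 (a b : R) (c : R -> M) : Prop :=
  exists2 s : seq R, itv_partition a b s &
    forall k, (k < size s)%N ->
      let u := nth a (a :: s) k in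
      let v := nth a (a :: s) k.+1 in
      exists (e : R) (h : R -> M),
        [/\ 0 < e, C1_curve `]u - e, v + e[ h &
            forall t, t \in `[u, v] -> c t = h t].

(* The Riemannian norm of c'(t), computed in a chart around c t. At the
   finitely many break points the value is irrelevant. *)
Definition speed (c : R -> M) (t : R) : R :=
  let i := chart_at (c t) in
  let w := ((cmap (atlas i) \o c)^`())%classic t in
  Num.sqrt ((w *m g i (cmap (atlas i) (c t)) *m w^T) 0 0).

Definition curve_length (a b : R) (c : R -> M) : \bar R :=
  (\int[@lebesgue_measure R]_(t in `[a, b]) (speed c t)%:E)%E.

Definition riemannian_dist (p q : M) : \bar R :=
  ereal_inf [set l : \bar R | exists (a b : R) (c : R -> M),
    [/\ piecewise_C1 a b c, c a = p, c b = q & l = curve_length a b c]].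

Definition C0_cvg (psi_ : nat -> M -> M) (psi : M -> M) : Prop :=
  ereal_sup [set riemannian_dist (psi_ k x) (psi x) | x in [set: M]]
    @[k --> \oo] --> 0%E.

End Riemannian.

(* Main.v *)
Require Import Defs.
From mathcomp Require Import all_boot all_order all_algebra.
From mathcomp Require Import all_classical all_reals all_analysis.
From mathcomp Require Import measurable_realfun.
From mathcomp Require Import ring lra.
Set Implicit Arguments.
Unset Strict Implicit.
Unset Printing Implicit Defensive.
Import Order.TTheory GRing.Theory Num.Theory.
Import numFieldNormedType.Exports.
Local Open Scope classical_set_scope.
Local Open Scope ring_scope.


(** An isometry [phi] preserves the length of every piecewise C^1 curve, and so
    does its smooth inverse; hence it preserves the Riemannian distance d
    ([riemannian_dist_isometry]).  A pointwise limit of distance-preserving maps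
    preserves distances as well, and a smooth distance-preserving map is a
    Riemannian isometry because d determines the metric infinitesimally: in a
    chart around a point of coordinates x0, with N the norm of the inner product
    g(x0), the quotient of d by N tends to 1 near x0.

    That local comparison is made quantitative with a factor K > 1 as close to 1
    as desired.  On a small enough N-ball around x0 all the Gram matrices g(x)
    are comparable to g(x0) up to K ([comparable_ball_exists]).  Segments of the
    chart then give d <= K N ([dist_le_coord]).  The converse N <= K d
    ([coord_dist_le]) must also account for curves that might leave the chart:
    a curve that ends in the ball and is too short to reach its boundary never
    leaves it ([no_exit_piece], [no_exit_curve]): after the last time spent
    outside, it would stay in a smaller closed ball, which is compact, hence
    closed in M, and so it could not have been outside at that last time.

    Combined for psi_k with k large, these bounds show that the expression F of
    psi in charts satisfies both N'(F x - F x0) <= K^2 N(x - x0) and the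
    symmetric inequality for x near x0 ([limit_near_isometric]).  The points
    psi_k p and psi p are compared through the curves from the former to the
    latter, and the errors are added up in coordinates, by the triangle
    inequality of the norm.  Dividing by the length of x - x0 and letting it
    tend to 0, the differential of F at x0 distorts norms by at most K^2, for
    every K > 1; so it preserves them, and by polarization psi^* g = g
    ([limit_pullback]). *)

(** * Inner products given by Gram matrices *)

Lemma cvg_fin_sum (K : numFieldType) (V : normedModType K) (T : Type)
    (F : set_system T) (FF : Filter F) m (f : 'I_m -> T -> V) (l : 'I_m -> V) :
  (forall i, f i @ F --> l i) ->
  (fun t => \sum_(i < m) f i t) @ F --> \sum_(i < m) l i.
Proof.
move=> fl; apply: (@cvg_big _ _ +%R) => // -[x y].
exact: add_continuous.
Qed.

(** Splits a length budget [l] between two consecutive arcs of a curve. *)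
Lemma adde_le_fin (R : realDomainType) (x y : \bar R) (l : R) :
  (0 <= x -> 0 <= y -> x + y <= l%:E ->
   exists l1 l2, [/\ x <= l1%:E, y <= l2%:E, 0 <= l1%:E, 0 <= l2%:E &
                   (l1 + l2)%:E <= l%:E])%E.
Proof. by case: x y => [x| |] [y| |]//; exists x, y. Qed.

(** For 0 < b < a, the choice K^2 = (1 + a / b) / 2 would give a <= (a + b) / 2. *)
Lemma ler_sqr_factor (R : realType) (a b : R) : 0 <= b ->
  (forall K, 1 < K -> a <= K ^+ 2 * b) -> a <= b.
Proof.
move=> b0 ab; rewrite leNgt; apply/negP => ba.
move: b0; rewrite le_eqVlt => /predU1P[b0|b0].
  by have := ab 2; rewrite -b0 mulr0 => /(_ (ltr1n R 2)); rewrite leNgt b0 ba.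
pose q := (1 + a / b) / 2.
have q1 : 1 < q.
  have : 1 < a / b by rewrite ltr_pdivlMr// mul1r.
  rewrite /q; lra.
have q0 : 0 < q by exact: lt_trans q1.
have K1 : 1 < Num.sqrt q by rewrite -[X in X < _]sqrtr1 ltr_sqrt.
have := ab _ K1; rewrite sqr_sqrtr ?(ltW q0)//.
have -> : q * b = (b + a) / 2 by rewrite /q; field; rewrite gt_eqF.
lra.
Qed.

Section gram_matrix.
Variables (R : realType) (n : nat).
Implicit Types (A B : 'M[R]_n) (u v w : 'rV[R]_n).

Definition gram_form A u v : R := (u *m A *m v^T) 0 0.

Definition gram_norm A v : R := Num.sqrt (gram_form A v v).

Definition spd A : Prop :=
  A^T = A /\ forall v, v != 0 -> 0 < gram_form A v v.

Lemma gram_formE A u v :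
  gram_form A u v = \sum_(j < n) (\sum_(i < n) u 0 i * A i j) * v 0 j.
Proof. by rewrite /gram_form mxE; apply: eq_bigr => j _; rewrite !mxE. Qed.

Lemma gram_formDl A u v w : gram_form A (u + v) w = gram_form A u w + gram_form A v w.
Proof. by rewrite /gram_form mulmxDl mulmxDl mxE. Qed.

Lemma gram_formDr A u v w : gram_form A u (v + w) = gram_form A u v + gram_form A u w.
Proof. by rewrite /gram_form linearD mulmxDr mxE. Qed.

Lemma gram_formZl A k u v : gram_form A (k *: u) v = k * gram_form A u v.
Proof. by rewrite /gram_form -!scalemxAl mxE. Qed.

Lemma gram_formZr A k u v : gram_form A u (k *: v) = k * gram_form A u v.
Proof. by rewrite /gram_form linearZ -scalemxAr mxE. Qed.

Lemma gram_formBr A u v w : gram_form A u (v - w) = gram_form A u v - gram_form A u w.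
Proof. by rewrite -scaleN1r gram_formDr gram_formZr mulN1r. Qed.

Lemma gram_form_subm A B u v : gram_form (A - B) u v = gram_form A u v - gram_form B u v.
Proof. by rewrite /gram_form mulmxBr mulmxBl mxE [in X in _ + X]mxE. Qed.

Lemma gram_formC A u v : A^T = A -> gram_form A u v = gram_form A v u.
Proof.
move=> symA; rewrite /gram_form -[LHS](mxE trmx_key (fun i j => (u *m A *m v^T) j i)).
by rewrite -/(trmx _) !trmx_mul trmxK symA mulmxA.
Qed.

Lemma gram_form_mulmx A (J : 'M[R]_n) u v :
  gram_form A (u *m J) (v *m J) = gram_form (J *m A *m J^T) u v.
Proof. by rewrite /gram_form trmx_mul !mulmxA. Qed.

Lemma gram_form_ge0 A v : spd A -> 0 <= gram_form A v v.
Proof.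
case=> _ pA; have [->|/pA/ltW//] := eqVneq v 0.
by rewrite /gram_form !mul0mx mxE.
Qed.

Lemma gram_norm_ge0 A v : 0 <= gram_norm A v.
Proof. exact: sqrtr_ge0. Qed.

Lemma sqr_gram_norm A v : spd A -> gram_norm A v ^+ 2 = gram_form A v v.
Proof. by move=> /gram_form_ge0 A0; rewrite sqr_sqrtr. Qed.

Lemma gram_norm0 A : gram_norm A 0 = 0.
Proof. by rewrite /gram_norm /gram_form !mul0mx mxE sqrtr0. Qed.

Lemma gram_normZ A k v : spd A -> gram_norm A (k *: v) = `|k| * gram_norm A v.
Proof.
move=> /gram_form_ge0 A0; rewrite /gram_norm gram_formZl gram_formZr mulrA sqrtrM -?expr2 ?sqr_ge0//.
by rewrite sqrtr_sqr.
Qed.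

Lemma gram_norm_sub A u v : spd A -> gram_norm A (u - v) = gram_norm A (v - u).
Proof. by move=> sA; rewrite -opprB -scaleN1r gram_normZ// normrN1 mul1r. Qed.

Lemma gram_norm_gt0 A v : spd A -> v != 0 -> 0 < gram_norm A v.
Proof. by case=> _ pA v0; rewrite sqrtr_gt0; exact: pA. Qed.

(** Nonnegativity of the form at <v, v> u - <u, v> v. *)
Lemma gram_form_CauchySchwarz A u v : spd A -> gram_form A u v <= gram_norm A u * gram_norm A v.
Proof.
move=> sA; have [->|v0] := eqVneq v 0.
  by rewrite gram_norm0 mulr0 /gram_form linear0 mulmx0 mxE.
have q0 : 0 < gram_form A v v by case: sA => _; exact.
have := gram_form_ge0 (gram_form A v v *: u - gram_form A u v *: v) sA.
rewrite -scaleNr !(gram_formDl, gram_formDr, gram_formZl, gram_formZr) (gram_formC v u); last by case: sA.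
set a := gram_form A u u; set b := gram_form A u v; set d := gram_form A v v.
rewrite (_ : _ + _ = d * (a * d - b ^+ 2)); last by ring.
rewrite pmulr_rge0// subr_ge0 => ba.
rewrite /gram_norm -sqrtrM ?gram_form_ge0// (le_trans (ler_norm _))//.
by rewrite -sqrtr_sqr ler_wsqrtr.
Qed.

Lemma ler_gram_normD A u v : spd A -> gram_norm A (u + v) <= gram_norm A u + gram_norm A v.
Proof.
move=> sA; rewrite -(@ler_pXn2r _ 2) ?nnegrE ?addr_ge0 ?gram_norm_ge0//.
rewrite sqr_gram_norm// gram_formDl !gram_formDr (gram_formC v u); last by case: sA.
rewrite sqrrD !sqr_gram_norm//.
have := gram_form_CauchySchwarz u v sA; lra.
Qed.

Lemma ler_dist_gram_norm A u v w : spd A ->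
  gram_norm A (u - w) <= gram_norm A (u - v) + gram_norm A (v - w).
Proof. by move=> sA; rewrite -(subrKA v) ler_gram_normD. Qed.

Lemma normr_row_le v i : `|v 0 i| <= `|v|.
Proof.
by rewrite [leRHS]/Num.norm /= mx_normrE; apply/bigmax_geP; right; exists (0, i).
Qed.

Lemma cvg_gram_form (T : Type) (F : set_system T) (FF : Filter F)
    (A_ : T -> 'M[R]_n) (u_ v_ : T -> 'rV[R]_n) A u v :
  A_ @ F --> A -> u_ @ F --> u -> v_ @ F --> v ->
  (fun t => gram_form (A_ t) (u_ t) (v_ t)) @ F --> gram_form A u v.
Proof.
move=> cA cu cv; rewrite gram_formE.
under eq_fun do rewrite gram_formE.
apply: cvg_fin_sum => j; apply: cvgM; last first.
  by exact: (cvg_comp _ _ cv (@coord_continuous _ _ _ ord0 j _)).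
apply: cvg_fin_sum => i; apply: cvgM.
  by exact: (cvg_comp _ _ cu (@coord_continuous _ _ _ ord0 i _)).
by exact: (cvg_comp _ _ cA (@coord_continuous _ _ _ i j _)).
Qed.

Lemma cvg_gram_norm (T : Type) (F : set_system T) (FF : Filter F)
    (A_ : T -> 'M[R]_n) (v_ : T -> 'rV[R]_n) A v :
  A_ @ F --> A -> v_ @ F --> v ->
  (fun t => gram_norm (A_ t) (v_ t)) @ F --> gram_norm A v.
Proof.
move=> cA cv; apply: (cvg_comp _ _ (cvg_gram_form FF cA cv cv)).
exact: sqrt_continuous.
Qed.

Lemma gram_norm_continuous A : continuous (gram_norm A).
Proof.
by move=> v; exact: (@cvg_gram_norm _ (nbhs v) _ _ id A v (cvg_cst A) (@cvg_id _ _)).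
Qed.

(** The constant is the minimum of the norm on the unit sphere of the sup norm,
    which is compact. *)
Lemma gram_norm_coercive A : spd A -> exists2 c, 0 < c & forall v, c * `|v| <= gram_norm A v.
Proof.
move=> sA; pose S : set 'rV[R]_n := [set v | `|v| = 1].
have unitS v : v != 0 -> S (`|v|^-1 *: v).
  by move=> v0; rewrite /S /= normrZ normfV normr_id mulVf// normr_eq0.
have [S0|/set0P S0] := eqVneq S set0.
  (* In dimension 0 the sphere is empty and every vector is 0. *)
  exists 1 => // v; have [->|/unitS] := eqVneq v 0; last by rewrite S0.
  by rewrite normr0 mulr0 gram_norm_ge0.
have cS : compact S.
  apply: bounded_closed_compact.
    exists 1; split; first exact: num_real.
    by move=> x x1 v /= ->; exact: ltW.
  apply: (@closed_comp _ _ (fun v : 'rV[R]_n => `|v|) [set 1]).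
    by move=> v _; exact: norm_continuous.
  exact: closed_eq.
have [m mS mmin] := EVT_min_rV S0 cS
  (continuous_subspaceT (@gram_norm_continuous A)).
rewrite inE in mS; exists (gram_norm A m).
  apply: gram_norm_gt0 => //; apply/eqP => m0; move: mS.
  by rewrite /S /= m0 normr0 => /eqP; rewrite eq_sym oner_eq0.
move=> v; have [->|v0] := eqVneq v 0; first by rewrite normr0 mulr0 gram_norm_ge0.
have v1 : 0 < `|v| by rewrite normr_gt0.
have /mmin : `|v|^-1 *: v \in S by rewrite inE; exact: unitS.
by rewrite gram_normZ// normfV normr_id ler_pdivlMl// mulrC.
Qed.

Lemma gram_norm_sub_continuous A (x0 : 'rV[R]_n) :
  continuous (fun x : 'rV[R]_n => gram_norm A (x - x0)).
Proof.
move=> x; apply: (cvg_gram_norm (nbhs_filter x) (cvg_cst A)).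
exact: (cvgB (f:=id) (g:=cst x0) (a:=x) (b:=x0) (F:=nbhs x) cvg_id (cvg_cst x0)).
Qed.

Lemma compact_gram_ball A x0 r : spd A ->
  compact [set x : 'rV[R]_n | gram_norm A (x - x0) <= r].
Proof.
move=> sA; have [c c0 cN] := gram_norm_coercive sA.
apply: bounded_closed_compact.
  exists (r / c + `|x0|); split; first exact: num_real.
  move=> y ry x /= xr; apply: le_trans (ltW ry).
  rewrite -[x in leLHS](subrK x0) (le_trans (ler_normD _ _))// lerD2r.
  by rewrite ler_pdivlMr// mulrC (le_trans (cN _)).
apply: (@closed_comp _ _ (fun x : 'rV[R]_n => gram_norm A (x - x0)) [set y | y <= r]).
  by move=> x _; exact: gram_norm_sub_continuous.
exact: closed_le.
Qed.

Lemma gram_form_le B e v : (forall i j, `|B i j| <= e) ->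
  `|gram_form B v v| <= (n ^ 2)%:R * e * `|v| ^+ 2.
Proof.
move=> Be; have sumC (x : R) : n%:R * x = \sum_(i < n) x.
  by rewrite sumr_const card_ord mulr_natl.
rewrite gram_formE (le_trans (ler_norm_sum _ _ _))//.
rewrite expnS expn1 natrM -!mulrA sumC; apply: ler_sum => j _.
rewrite normrM expr2 !mulrA; apply: ler_pM => //; last exact: normr_row_le.
rewrite (le_trans (ler_norm_sum _ _ _))// -mulrA sumC.
apply: ler_sum => i _; rewrite normrM mulrC.
by apply: ler_pM => //; exact: normr_row_le.
Qed.

(** If the entries of [A_ t - A] are small, the form of [A_ t - A] is at most [d]
    times that of [A], by coercivity of [A]; the bounds K^2 and K^-2 on the
    ratio of the two forms follow when 1 - d = K^-2, since then 1 + d <= K^2. *)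
Lemma gram_norm_near_comparable (T : Type) (F : set_system T) (FF : Filter F)
    (A_ : T -> 'M[R]_n) A K :
  1 < K -> spd A -> A_ @ F --> A ->
  \forall t \near F, forall v,
    gram_norm A v <= K * gram_norm (A_ t) v /\ gram_norm (A_ t) v <= K * gram_norm A v.
Proof.
move=> K1 sA cA; have [c c0 cN] := gram_norm_coercive sA.
have K0 : 0 < K by apply: lt_trans K1.
have K2 : 1 < K ^+ 2 by rewrite exprn_egt1.
pose d := 1 - (K ^+ 2)^-1.
have d0 : 0 < d by rewrite subr_gt0 invf_lt1// (lt_trans _ K2).
(* n^2 entries contribute at most e each; the successor avoids dividing by 0. *)
pose e := d * c ^+ 2 / (n ^ 2).+1%:R.
have e0 : 0 < e by rewrite divr_gt0// mulr_gt0// exprn_gt0.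
have nearA : \forall t \near F, `|A - A_ t| < e.
  by move/cvgrPdist_lt : cA; apply.
apply: filterS nearA => t At v.
have : `|gram_form (A_ t - A) v v| <= d * gram_form A v v.
  apply: (@le_trans _ _ ((n ^ 2)%:R * e * `|v| ^+ 2)).
    apply: gram_form_le => i j; rewrite distrC in At.
    apply: le_trans (ltW At).
    rewrite [leRHS]/Num.norm /= mx_normrE; apply/bigmax_geP; right.
    by exists (i, j).
  apply: (@le_trans _ _ (d * (c * `|v|) ^+ 2)); last first.
    rewrite ler_pM2l// -sqr_gram_norm//.
    by rewrite ler_pXn2r ?nnegrE ?gram_norm_ge0// mulr_ge0// ltW.
  rewrite exprMn [leRHS]mulrA ler_wpM2r ?sqr_ge0//.
  rewrite /e mulrCA ler_piMr//; first by rewrite mulr_ge0 ?sqr_ge0// ltW.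
  by rewrite ler_pdivrMr ?ltr0n// mul1r ler_nat.
rewrite gram_form_subm ler_norml => /andP[lo hi].
have g0 := gram_form_ge0 v sA.
have gt0 : 0 <= gram_form (A_ t) v v.
  apply: le_trans (_ : (K ^+ 2)^-1 * gram_form A v v <= _).
    by rewrite mulr_ge0// invr_ge0 sqr_ge0.
  by move: lo; rewrite /d; lra.
have sqrtE x : K * Num.sqrt x = Num.sqrt (K ^+ 2 * x).
  by rewrite sqrtrM ?sqr_ge0// sqrtr_sqr gtr0_norm.
rewrite /gram_norm !sqrtE; split; apply: ler_wsqrtr.
  rewrite -ler_pdivrMl ?exprn_gt0//; move: lo; rewrite /d; lra.
have dK : 1 + d <= K ^+ 2.
  rewrite /d; have k0 : 0 < K ^+ 2 by rewrite exprn_gt0.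
  rewrite -subr_ge0 (_ : _ - _ = (K ^+ 2 - 1) ^+ 2 / K ^+ 2).
    by rewrite divr_ge0 ?sqr_ge0.
  by field; rewrite gt_eqF.
apply: le_trans (_ : (1 + d) * gram_form A v v <= _); first by move: hi; lra.
exact: ler_wpM2r.
Qed.

(** Polarization recovers the bilinear form, whose values at pairs of basis
    vectors are the entries of the matrix. *)
Lemma gram_form_inj A B : A^T = A -> B^T = B ->
  (forall v, gram_form A v v = gram_form B v v) -> A = B.
Proof.
move=> sA sB AB; have pol u v : gram_form A u v = gram_form B u v.
  have := AB (u + v); rewrite !gram_formDl !gram_formDr (gram_formC v u sA) (gram_formC v u sB).
  by rewrite !AB; lra.
apply/matrixP => i j; have := pol (delta_mx 0 i) (delta_mx 0 j).
rewrite /gram_form trmx_delta -!rowE -!colE !mxE => ->//.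
Qed.

End gram_matrix.

(** * Curves of class C^1 in coordinates *)

Section C1_near.
Variables (R : realType) (n : nat).
Implicit Types (t : R) (c f : R -> 'rV[R]_n).

Lemma near_eq_continuous (T U : topologicalType) (f h : T -> U) (t : T) :
  {near t, f =1 h} -> {for t, continuous f} -> {for t, continuous h}.
Proof.
move=> fh cf; rewrite /prop_for /continuous_at -(nbhs_singleton fh).
by apply: cvg_trans cf; apply: near_eq_cvg.
Qed.

(** The local form of the conditions that [C1_curve] imposes in a chart: unlike
    them, it is invariant under changing [f] away from [t]. *)
Definition C1_near f t : Prop :=
  (\forall s \near t, derivable f s 1) /\
  {for t, continuous (f^`())%classic}.

Lemma near_eq_derive1 f h t :
  {near t, f =1 h} -> (f^`())%classic t = (h^`())%classic t.
Proof. by move=> fh; rewrite !derive1E; exact: near_eq_derive. Qed.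

Lemma near_eq_C1_near f h t :
  {near t, f =1 h} -> C1_near f t -> C1_near h t.
Proof.
move=> fh [df cf]; have fh2 := near_join fh; split.
  by apply: filterS2 fh2 df => s; exact: near_eq_derivable.
apply: near_eq_continuous cf.
by apply: filterS fh2 => s; exact: near_eq_derive1.
Qed.

Lemma C1_near_derivable f t : C1_near f t -> derivable f t 1.
Proof. by case=> /nbhs_singleton. Qed.

Lemma derivable_continuous_at f t : derivable f t 1 -> {for t, continuous f}.
Proof. by move=> /derivable1_diffP; exact: differentiable_continuous. Qed.

Lemma C1_near_continuous f t : C1_near f t -> {for t, continuous f}.
Proof. by move=> /C1_near_derivable; exact: derivable_continuous_at. Qed.

Lemma derive1_comp_jacobian (F : 'rV[R]_n -> 'rV[R]_n) c t :
  derivable c t 1 -> differentiable F (c t) ->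
  derivable (F \o c) t 1 /\
  ((F \o c)^`())%classic t = (c^`())%classic t *m 'J F (c t).
Proof.
move=> /derivable1_diffP dc dF.
have dFc := differentiable_comp dc dF; split; first exact/derivable1_diffP.
by rewrite derive1E' // diff_comp //= -derive1E' // -deriveE // deriveEjacobian.
Qed.

Lemma within_derivable_oo_LRcontinuous (f : R -> R) a b : a < b ->
  (forall t, t \in `[a, b] -> derivable f t 1) ->
  derivable_oo_LRcontinuous f a b.
Proof.
move=> ab df; have cf t : t \in `[a, b] -> f x @[x --> t] --> f t.
  by move=> /df /derivable1_diffP /differentiable_continuous.
split.
- by move=> t tab; apply: df; exact: subset_itv_oo_cc.
- by apply: cvg_at_right_filter; apply: cf; rewrite in_itv /= lexx ltW.
- by apply: cvg_at_left_filter; apply: cf; rewrite in_itv /= lexx ltW.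
Qed.

Lemma derive1_gram_form (A : 'M[R]_n) (w : 'rV[R]_n) (X : R -> 'rV[R]_n) t :
  derivable X t 1 ->
  derivable (fun s => gram_form A w (X s)) t 1 /\
  ((fun s => gram_form A w (X s))^`())%classic t
    = gram_form A w ((X^`())%classic t).
Proof.
move=> dX; set f := fun s => _.
have lf : (fun e => e^-1 *: (f (e *: 1 + t) - f t)) @ (0^') -->
          gram_form A w ((X^`())%classic t).
  rewrite derive1E.
  have -> : (fun e => e^-1 *: (f (e *: 1 + t) - f t)) =
            (fun e => gram_form A w (e^-1 *: (X (e *: 1 + t) - X t))).
    by apply/funext => e; rewrite gram_formZr gram_formBr.
  by apply: cvg_gram_form; [exact: cvg_cst|exact: cvg_cst|exact: dX].
split; first by apply/cvg_ex; exists (gram_form A w ((X^`())%classic t)).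
by rewrite derive1E; apply: cvg_lim.
Qed.

(** The norm of the differential is the limit of the norms of difference
    quotients, so a bound on increments of [F] passes to its differential; the
    next lemmas use this in both directions. *)
Lemma gram_norm_diff_cvg (A' : 'M[R]_n) (F : 'rV[R]_n -> 'rV[R]_n) x0 v :
  differentiable F x0 ->
  (fun h : R => gram_norm A' (h^-1 *: (F (h *: v + x0) - F x0))) @ 0^' -->
    gram_norm A' (v *m 'J F x0).
Proof.
move=> dF; apply: cvg_gram_norm; first exact: cvg_cst.
rewrite -deriveEjacobian//.
exact: (@diff_derivable _ _ _ F x0 v dF).
Qed.

Lemma line_cvg (x0 v : 'rV[R]_n) : h *: v + x0 @[h --> (0 : R)^'] --> x0.
Proof.
have c0 : h @[h --> (0 : R)^'] --> (0 : R).
  by apply: cvg_within_filter; exact: cvg_id.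
have := cvgD (cvgZr_tmp (a := v) c0) (cvg_cst x0).
rewrite scale0r add0r; exact.
Qed.

Lemma gram_norm_jacobian_le (A A' : 'M[R]_n) (F : 'rV[R]_n -> 'rV[R]_n) x0 C :
  spd A -> spd A' -> differentiable F x0 ->
  (\forall x \near x0, gram_norm A' (F x - F x0) <= C * gram_norm A (x - x0)) ->
  forall v, gram_norm A' (v *m 'J F x0) <= C * gram_norm A v.
Proof.
move=> sA sA' dF nF v; have cF := @gram_norm_diff_cvg A' F x0 v dF.
apply: (@closed_cvg _ _ 0^' _ _ [set y | y <= C * gram_norm A v] _ _ _ cF).
  exact: closed_le.
have h0 : \forall h \near (0 : R)^', h != 0 by exact: nbhs_dnbhs_neq.
apply: filterS2 h0 (line_cvg v nF) => h h0 /=.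
rewrite addrK !gram_normZ// mulrCA normfV => H.
by rewrite ler_pdivrMl ?normr_gt0.
Qed.

Lemma gram_norm_jacobian_ge (A A' : 'M[R]_n) (F : 'rV[R]_n -> 'rV[R]_n) x0 C :
  spd A -> spd A' -> differentiable F x0 ->
  (\forall x \near x0, gram_norm A (x - x0) <= C * gram_norm A' (F x - F x0)) ->
  forall v, gram_norm A v <= C * gram_norm A' (v *m 'J F x0).
Proof.
move=> sA sA' dF nF v; have cF := @gram_norm_diff_cvg A' F x0 v dF.
have cCF : C * gram_norm A' (h^-1 *: (F (h *: v + x0) - F x0)) @[h --> 0^'] -->
    C * gram_norm A' (v *m 'J F x0) by exact: cvgM (cvg_cst C) cF.
apply: (@closed_cvg _ _ 0^' _ _ [set y | gram_norm A v <= y] _ _ _ cCF).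
  exact: closed_ge.
have h0 : \forall h \near (0 : R)^', h != 0 by exact: nbhs_dnbhs_neq.
apply: filterS2 h0 (line_cvg v nF) => h h0 /=.
rewrite addrK !gram_normZ// normfV => H.
by rewrite mulrCA ler_pdivlMl ?normr_gt0.
Qed.

(** The derivative of the composite is c' *m 'J F (c s), a combination of the
    partial derivatives of F along c with the entries of c' as coefficients;
    both factors are continuous. *)
Lemma C1_near_comp (U : set 'rV[R]_n) (F : 'rV[R]_n -> 'rV[R]_n) c t :
  open U -> smooth_on U F -> U (c t) -> C1_near c t ->
  C1_near (F \o c) t /\
  ((F \o c)^`())%classic t = (c^`())%classic t *m 'J F (c t).
Proof.
move=> oU sF Uct Cc; have ct := C1_near_continuous Cc.
have dF x : U x -> differentiable F x by case: (sF 1%N) => + _; exact.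
have [dc c't] := Cc.
have Uc : \forall s \near t, U (c s) by apply: ct; exact: open_nbhs_nbhs.
have D s : U (c s) -> derivable c s 1 ->
    derivable (F \o c) s 1 /\
    ((F \o c)^`())%classic s = (c^`())%classic s *m 'J F (c s).
  by move=> ? ?; apply: derive1_comp_jacobian => //; exact: dF.
split; last by apply: (D _ Uct (nbhs_singleton dc)).2.
split; first by apply: filterS2 Uc dc => s Us ds; exact: (D s Us ds).1.
pose G s := \sum_(i < n) (c^`())%classic s 0 i *: 'D_(delta_mx 0 i) F (c s).
apply: (@near_eq_continuous _ _ G).
  apply: filterS2 Uc dc => s Us ds; rewrite (D s Us ds).2.
  rewrite [X in X *m _]row_sum_delta mulmx_suml; apply: eq_bigr => i _.
  by rewrite -scalemxAl deriveEjacobian//; exact: dF.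
apply: cvg_fin_sum => i; apply: cvgZ.
  exact: (cvg_comp _ _ c't (@coord_continuous _ _ _ ord0 i _)).
have [_ /(_ (delta_mx 0 i)) cD] := sF 1%N.
exact: (cvg_comp _ _ ct (cD _ Uct)).
Qed.

End C1_near.

(** * Curves on the manifold *)

Section curves.
Variables (R : realType) (n : nat) (M : smooth_manifold R n).
Implicit Types (i j : atlas_index M) (phi : M -> M) (c : R -> M).

Lemma open_cinv_preimage i (h : M -> M) (V : set M) :
  continuous h -> open V ->
  open (ccod (atlas i) `&` (h \o cinv (atlas i)) @^-1` V).
Proof.
move=> ch oV; rewrite openE => x [cx Vx]; apply: filterI.
  by apply: open_nbhs_nbhs; split => //; exact: ccod_open.
have : {for x, continuous (h \o cinv (atlas i))}.
  by apply: continuous_comp; [exact: cinv_continuous|exact: ch].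
by apply; apply: open_nbhs_nbhs.
Qed.

Lemma near_cdom i c t : {for t, continuous c} -> cdom (atlas i) (c t) ->
  \forall s \near t, cdom (atlas i) (c s).
Proof.
move=> cc it; apply: cc; apply: open_nbhs_nbhs; split => //.
exact: cdom_open.
Qed.

(** The local expressions of the identity are the transition maps, so changes of
    charts are handled as a special case of smooth maps. *)
Lemma smooth_map_id : smooth_map (@id M).
Proof. by split=> [p|i j]; [exact: cvg_id|exact: transition_smooth]. Qed.

Lemma smooth_map_cont phi : smooth_map phi -> continuous phi.
Proof. by case. Qed.

Lemma local_expr_comp phi i j c t :
  {for t, continuous c} -> cdom (atlas i) (c t) ->
  {near t, local_expr phi i j \o (cmap (atlas i) \o c)
           =1 cmap (atlas j) \o phi \o c}.
Proof.
move=> cc it; apply: filterS (near_cdom cc it) => s si.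
by rewrite /local_expr /= cmapK.
Qed.

(** The chain rule in charts.  With [phi] the identity it is the change of
    coordinates for velocities. *)
Lemma C1_near_local_expr phi i j c t :
  smooth_map phi -> {for t, continuous c} ->
  cdom (atlas i) (c t) -> cdom (atlas j) (phi (c t)) ->
  C1_near (cmap (atlas i) \o c) t ->
  C1_near (cmap (atlas j) \o phi \o c) t /\
  ((cmap (atlas j) \o phi \o c)^`())%classic t =
    ((cmap (atlas i) \o c)^`())%classic t
      *m 'J (local_expr phi i j) (cmap (atlas i) (c t)).
Proof.
move=> [cphi sphi] cc it jt C1c.
have E := local_expr_comp phi j cc it.
have [] := C1_near_comp (@open_cinv_preimage i phi _ cphi (@cdom_open _ _ _ (atlas j)))
  (sphi i j) _ C1c.
  by split => /=; [exact: cmap_cod|rewrite cmapK].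
move=> C1F <-; split; first exact: near_eq_C1_near E C1F.
by rewrite (near_eq_derive1 E).
Qed.

Lemma C1_curve_near (D : set R) c t i : open D -> C1_curve D c -> D t ->
  cdom (atlas i) (c t) -> C1_near (cmap (atlas i) \o c) t.
Proof.
move=> oD Dc Dt it; have [cc ct] := Dc t Dt; split; last by case: (ct i it).
apply: filterS2 (open_nbhs_nbhs (conj oD Dt)) (near_cdom cc it) => s Ds si.
by have [_ /(_ i si)[]] := Dc s Ds.
Qed.

Lemma C1_curve_comp (D : set R) c phi : open D -> smooth_map phi ->
  C1_curve D c -> C1_curve D (phi \o c).
Proof.
move=> oD sphi Dc t Dt; have [cc _] := Dc t Dt; split.
  by apply: continuous_comp => //; exact: smooth_map_cont.
move=> j jt; have it := chart_atP (c t).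
have [C1c _] := C1_near_local_expr sphi cc it jt (C1_curve_near oD Dc Dt it).
by split; [exact: C1_near_derivable|case: C1c].
Qed.

Definition C1_piece (u v : R) c : Prop :=
  exists (e : R) (h : R -> M),
    [/\ 0 < e, C1_curve `]u - e, v + e[ h & forall t, t \in `[u, v] -> c t = h t].

Lemma C1_piece_comp u v c phi : smooth_map phi ->
  C1_piece u v c -> C1_piece u v (phi \o c).
Proof.
move=> sphi [e [h [e0 Ch ch]]].
exists e, (phi \o h); split => //; last by move=> t /ch /= ->.
by apply: C1_curve_comp => //; exact: interval_open.
Qed.

Lemma piecewise_C1_comp a b c phi : smooth_map phi ->
  piecewise_C1 a b c -> piecewise_C1 a b (phi \o c).
Proof.
by move=> sphi [s abs H]; exists s => // k ks; exact: C1_piece_comp (H k ks).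
Qed.

End curves.

(** * Speed of a curve *)

Section speed.
Variables (R : realType) (n : nat) (M : smooth_manifold R n).
Variable g : riemannian_metric M.
Implicit Types (i j : atlas_index M) (phi : M -> M) (c : R -> M).

Lemma gram_spd i x : ccod (atlas i) x -> spd (g i x).
Proof. by move=> ix; split; [exact: gram_sym|exact: gram_posdef]. Qed.

Lemma speedE c t : speed g c t =
  gram_norm (g (chart_at (c t)) (cmap (atlas (chart_at (c t))) (c t)))
    (((cmap (atlas (chart_at (c t))) \o c)^`())%classic t).
Proof. by []. Qed.

Lemma speed_ge0 c t : 0 <= speed g c t.
Proof. exact: sqrtr_ge0. Qed.

(** [speed] picks a chart that jumps from one time to another; invariance of the
    metric under transitions allows any fixed chart instead, which is what makes
    the speed a continuous function of time. *)
Lemma speed_chart i c t : {for t, continuous c} -> cdom (atlas i) (c t) ->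
  C1_near (cmap (atlas i) \o c) t ->
  speed g c t =
    gram_norm (g i (cmap (atlas i) (c t))) (((cmap (atlas i) \o c)^`())%classic t).
Proof.
move=> cc it C1c; rewrite speedE; set j := chart_at _.
have jt : cdom (atlas j) (c t) by exact: chart_atP.
have [_ ->] := C1_near_local_expr (@smooth_map_id _ _ M) cc it jt C1c.
rewrite /gram_norm gram_form_mulmx (@gram_transition _ _ _ g i j) ?cmapK//=.
  by rewrite cmapK.
exact: cmap_cod.
Qed.

Lemma speed_isometry phi c t : Iso g phi -> {for t, continuous c} ->
  C1_near (cmap (atlas (chart_at (c t))) \o c) t ->
  speed g (phi \o c) t = speed g c t.
Proof.
move=> [[sphi _] iphi] cc; rewrite [RHS]speedE.
have := chart_atP (c t); set i := chart_at (c t) => it C1c.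
rewrite speedE /=; set j := chart_at _.
have jt : cdom (atlas j) (phi (c t)) by exact: chart_atP.
have [_ E] := C1_near_local_expr sphi cc it jt C1c.
rewrite -[g i _]iphi; last exact: cmap_cod.
rewrite {}E /gram_norm gram_form_mulmx /pullback cmapK// -/j.
by rewrite [local_expr phi i j (cmap _ _)]/local_expr /= cmapK.
Qed.

Lemma near_eq_speed c h t : {near t, c =1 h} -> speed g c t = speed g h t.
Proof.
move=> ch; rewrite !speedE -(nbhs_singleton ch); congr gram_norm.
by apply: near_eq_derive1; apply: filterS ch => s /= ->.
Qed.

Lemma speed_continuous (D : set R) c t : open D -> C1_curve D c -> D t ->
  {for t, continuous (speed g c)}.
Proof.
move=> oD Dc Dt; have [cc _] := Dc t Dt; have it := chart_atP (c t).
set i := chart_at _ in it; have C1c := C1_curve_near oD Dc Dt it.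
apply: (@near_eq_continuous _ _ (fun s =>
    gram_norm (g i (cmap (atlas i) (c s))) (((cmap (atlas i) \o c)^`())%classic s))).
  apply: filterS2 (open_nbhs_nbhs (conj oD Dt)) (near_cdom cc it) => s Ds si.
  have [cs _] := Dc s Ds.
  exact: esym (speed_chart cs si (C1_curve_near oD Dc Ds si)).
have cx := C1_near_continuous C1c.
apply: cvg_gram_norm; last by case: C1c.
apply: (cvg_comp _ _ cx); apply: (gram_smooth g i 0%N).
exact: cmap_cod.
Qed.

End speed.

(** * Length of curves and invariance under isometries *)

Section length.
Variables (R : realType) (n : nat) (M : smooth_manifold R n).
Variable g : riemannian_metric M.
Implicit Types (phi : M -> M) (c h : R -> M) (a b u v : R).
Local Notation mu := (@lebesgue_measure R).

(** Induction on the number of pieces, adding them at the start of the curve, the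
    end point [b] being fixed. *)
Lemma piecewise_C1_rect b c (P : R -> Prop) : P b ->
  (forall u v, u < v -> v <= b -> C1_piece u v c -> piecewise_C1 v b c ->
     P v -> P u) ->
  forall a, piecewise_C1 a b c -> P a.
Proof.
move=> Pb Pstep a [s]; elim: s a => [|v s IH] a; first by move=> /itv_partition_nil ->.
move=> abs H; have [/= /andP[av _] _] := abs.
have vbs := itv_partition_cons abs.
have Hs k : (k < size s)%N -> C1_piece (nth v (v :: s) k) (nth v (v :: s) k.+1) c.
  move=> ks; have := H k.+1 ks; rewrite /C1_piece /=.
  by rewrite !(set_nth_default v a) //= ltnW.
apply: (Pstep a v) => //; first exact: itv_partition_le vbs.
- exact: H 0%N isT.
- by exists s.
- exact: IH.
Qed.

Lemma subset_widen (u v e : R) : 0 < e -> `[u, v] `<=` `]u - e, v + e[.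
Proof.
move=> e0 t /=; rewrite !in_itv /= => /andP[ut tv]; apply/andP; split; lra.
Qed.

Lemma open_widen (u v e : R) : open `]u - e, v + e[%classic.
Proof. exact: interval_open. Qed.

Lemma speed_within_continuous (D : set R) h u v : open D -> C1_curve D h ->
  `[u, v] `<=` D -> {within `[u, v], continuous (speed g h)}.
Proof.
move=> oD Dh uvD; apply: continuous_in_subspaceT => t /set_mem /uvD Dt.
exact: speed_continuous oD Dh Dt.
Qed.

Lemma speed_integrable (D : set R) h u v : open D -> C1_curve D h ->
  `[u, v] `<=` D -> mu.-integrable `[u, v] (EFin \o speed g h).
Proof.
move=> oD Dh uvD; apply: continuous_compact_integrable.
  exact: segment_compact.
exact: speed_within_continuous oD Dh uvD.
Qed.

(** The curves [c] and [h] coincide near an interior time, so they have the same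
    derivative there.  At [u] and [v] they need not: the speed of [c] may be
    arbitrary at a break point, whence the passage through open intervals in
    the lemmas on measurability and length. *)
Lemma speed_piece_interior u v c h :
  (forall t, t \in `[u, v] -> c t = h t) ->
  forall t, t \in `]u, v[ -> speed g c t = speed g h t.
Proof.
move=> ch t tuv; apply: near_eq_speed.
have : \forall s \near t, s \in `]u, v[.
  by apply: open_nbhs_nbhs; split; [exact: interval_open|].
by apply: filterS => s suv; apply: ch; exact: subset_itv_oo_cc.
Qed.

Lemma measurable_speed_piece u v c : C1_piece u v c ->
  measurable_fun `[u, v] (speed g c).
Proof.
move=> [e [h [e0 Dh ch]]]; apply: (@measurable_fun_itv_cc _ u v false true).
have mh : measurable_fun `]u, v[ (speed g h).
  apply: (@measurable_funS _ _ _ _ `[u, v]) => //.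
    exact: subset_itv_oo_cc.
  have := speed_integrable (@open_widen u v e) Dh (@subset_widen u v e e0).
  by move=> /measurable_int/measurable_EFinP.
apply: eq_measurable_fun mh => t /set_mem /= tuv.
by apply/esym; exact: speed_piece_interior ch t tuv.
Qed.

Lemma curve_length_piece u v c h :
  measurable_fun `[u, v] (speed g c) -> measurable_fun `[u, v] (speed g h) ->
  (forall t, t \in `[u, v] -> c t = h t) ->
  curve_length g u v c = curve_length g u v h.
Proof.
move=> mc mh ch; rewrite /curve_length.
have E f : measurable_fun `[u, v] (speed g f) ->
    (\int[mu]_(t in `]u, v[) (speed g f t)%:E = \int[mu]_(t in `[u, v]) (speed g f t)%:E)%E.
  move=> /measurable_EFinP mf; rewrite integral_itv_bndo_bndc.
    rewrite integral_itv_obnd_cbnd//.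
    by apply: measurable_funS mf => //; apply: subset_itvr; rewrite bnd_simp.
  by apply: measurable_funS mf => //; exact: subset_itv_oo_cc.
have Eoo : (\int[mu]_(t in `]u, v[) (speed g c t)%:E =
            \int[mu]_(t in `]u, v[) (speed g h t)%:E)%E.
  apply: eq_integral => t; rewrite inE => tuv.
  exact: f_equal (speed_piece_interior ch tuv).
exact (etrans (esym (E c mc)) (etrans Eoo (E h mh))).
Qed.

Lemma measurable_speed_join u v b c : u < v -> v <= b -> C1_piece u v c ->
  measurable_fun `[v, b] (speed g c) -> measurable_fun `[u, b] (speed g c).
Proof.
move=> uv vb pc mvb.
rewrite (@itv_bndbnd_setU _ _ (BLeft u) (BRight v)); [|by rewrite bnd_simp // ltW..].
apply/measurable_funU => //; split; first exact: measurable_speed_piece.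
by apply: measurable_funS mvb => //; apply: subset_itvr; rewrite bnd_simp.
Qed.

Lemma measurable_speed a b c : piecewise_C1 a b c ->
  measurable_fun `[a, b] (speed g c).
Proof.
move: a; apply: piecewise_C1_rect.
  by rewrite set_itv1; exact: measurable_fun_set1.
by move=> u v uv vb pc _; exact: measurable_speed_join.
Qed.

Lemma measurable_speed_cons u v b c : u < v -> v <= b -> C1_piece u v c ->
  piecewise_C1 v b c -> measurable_fun `[u, b] (speed g c).
Proof.
by move=> uv vb pc /measurable_speed; exact: measurable_speed_join.
Qed.

Lemma curve_length_ge0 a b c : (0 <= curve_length g a b c)%E.
Proof. by apply: integral_ge0 => t _; rewrite lee_fin speed_ge0. Qed.

Lemma curve_length0 a c : curve_length g a a c = 0%E.
Proof. by rewrite /curve_length set_itv1; exact (integral_set1 _ _). Qed.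

Lemma curve_length_split a v b c : a <= v -> v <= b ->
  measurable_fun `[a, b] (speed g c) ->
  curve_length g a b c = (curve_length g a v c + curve_length g v b c)%E.
Proof.
move=> av vb /measurable_EFinP mc; rewrite /curve_length.
rewrite [X in (\int[_]_(_ in X) _)%E = _](@itv_bndbnd_setU _ _ (BLeft a) (BLeft v)) ?bnd_simp//.
rewrite ge0_integral_setU//=.
- rewrite integral_itv_bndo_bndc//.
  apply: measurable_funS mc => //; apply: subset_itvl; rewrite bnd_simp; lra.
- by rewrite -itv_bndbnd_setU// bnd_simp.
- by move=> t _; rewrite lee_fin speed_ge0.
- apply/disj_setPS => y [/=]; rewrite 2!in_itv/= => /andP[_ yx] /andP[].
  by rewrite leNgt yx.
Qed.

Lemma curve_length_isometry phi a b c : Iso g phi -> piecewise_C1 a b c ->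
  curve_length g a b (phi \o c) = curve_length g a b c.
Proof.
move=> iphi; have sphi : smooth_map phi by case: iphi => -[].
move: a; apply: piecewise_C1_rect; first by rewrite !curve_length0.
move=> u v uv vb pc pcb.
have pphi := C1_piece_comp sphi pc.
have [e [h [e0 Dh ch]]] := pc.
have oD := @open_widen u v e.
have Dph := C1_curve_comp oD sphi Dh.
have uvD := @subset_widen u v e e0.
have mS f : C1_curve `]u - e, v + e[ f -> measurable_fun `[u, v] (speed g f).
  by move=> Df; have /measurable_int/measurable_EFinP := speed_integrable oD Df uvD.
have Ec := curve_length_piece (measurable_speed_piece pc) (mS h Dh) ch.
have Ephi : curve_length g u v (phi \o c) = curve_length g u v (phi \o h).
  apply: curve_length_piece (measurable_speed_piece pphi) (mS _ Dph) _.
  by move=> t /ch /= ->.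
have Eh : curve_length g u v (phi \o h) = curve_length g u v h.
  clear Ec Ephi; apply: eq_integral => t; rewrite inE => /uvD Dt.
  apply: f_equal; apply: (speed_isometry iphi); first by case: (Dh t Dt).
  exact: (C1_curve_near oD Dh Dt (chart_atP _)).
have mc := measurable_speed_cons uv vb pc pcb.
have mphi := measurable_speed_cons uv vb pphi (piecewise_C1_comp sphi pcb).
rewrite (curve_length_split (ltW uv) vb mc) (curve_length_split (ltW uv) vb mphi).
by move=> ->; rewrite Ephi Eh Ec.
Qed.

(** The curves from p to q and those from phi p to phi q correspond to each other
    by composition with phi and with its inverse.  Length is preserved by the
    inverse because phi maps the transported curve back to the original one. *)
Lemma riemannian_dist_isometry phi p q : Iso g phi ->
  riemannian_dist g (phi p) (phi q) = riemannian_dist g p q.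
Proof.
move=> iphi; have [[sphi [phi' [sphi' phiK phi'K]]] _] := iphi.
congr ereal_inf; apply/seteqP; split=> _ [a [b [c [pc ca cb ->]]]].
  have pc' := piecewise_C1_comp sphi' pc.
  exists a, b, (phi' \o c); split; [exact: pc'|by rewrite /= ca|by rewrite /= cb|].
  rewrite -(curve_length_isometry iphi pc'); apply: f_equal.
  by apply/funext => t /=; rewrite phi'K.
exists a, b, (phi \o c); split.
- exact: piecewise_C1_comp.
- by rewrite /= ca.
- by rewrite /= cb.
- exact: esym (curve_length_isometry iphi pc).
Qed.

End length.

(** * Comparison of the distance with a norm in a chart *)

Section distance.
Variables (R : realType) (n : nat) (M : smooth_manifold R n).
Variable g : riemannian_metric M.
Implicit Types (phi : M -> M) (c h : R -> M) (a b u v t : R).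
Local Notation mu := (@lebesgue_measure R).

(** Let w be the total displacement in coordinates.  The function <w, x(t)> has
    increment N(w)^2 along the curve and derivative at most
    N(w) N(x'(t)) <= K N(w) speed(t), so integrating gives N(w) <= K length. *)
Lemma displacement_le_length (A : 'M[R]_n) K (i : atlas_index M) (D : set R) h u v l :
  spd A -> 0 < K -> open D -> C1_curve D h -> u <= v -> `[u, v] `<=` D ->
  (forall t, t \in `[u, v] -> cdom (atlas i) (h t) /\
    forall w, gram_norm A w <= K * gram_norm (g i (cmap (atlas i) (h t))) w) ->
  (curve_length g u v h <= l%:E)%E ->
  gram_norm A (cmap (atlas i) (h v) - cmap (atlas i) (h u)) <= K * l.
Proof.
move=> sA K0 oD Dh; rewrite le_eqVlt => /predU1P[<- _ _ hl|uv uvD hK hl].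
  have l0 : 0 <= l by rewrite -lee_fin (le_trans (curve_length_ge0 g _ _ _) hl).
  by rewrite subrr gram_norm0 mulr_ge0// ltW.
pose X := cmap (atlas i) \o h; set w := _ - _.
have C1X t : t \in `[u, v] -> C1_near X t.
  move=> tuv; have [it _] := hK t tuv.
  by apply: C1_curve_near oD Dh _ it; exact: uvD.
pose f t := gram_form A w (X t); pose f' t := gram_form A w ((X^`())%classic t).
have df t : t \in `[u, v] -> derivable f t 1 /\ (f^`())%classic t = f' t.
  by move=> /C1X/C1_near_derivable; exact: derive1_gram_form.
have cf' : {within `[u, v], continuous f'}.
  apply: continuous_in_subspaceT => t /set_mem /= tuv.
  apply: cvg_gram_form; [exact: cvg_cst|exact: cvg_cst|].
  by case: (C1X t tuv).
have int_s := speed_integrable g oD Dh uvD.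
have int_f' : mu.-integrable `[u, v] (EFin \o f').
  by apply: continuous_compact_integrable => //; exact: segment_compact.
have : (\int[mu]_(t in `[u, v]) (f' t)%:E <= (gram_norm A w * K)%:E * l%:E)%E.
  apply: (@le_trans _ _ ((gram_norm A w * K)%:E * curve_length g u v h)%E); last first.
    by apply: lee_wpmul2l => //; rewrite lee_fin mulr_ge0 ?gram_norm_ge0 ?(ltW K0).
  rewrite /curve_length -integralZl//.
  apply: le_integral => //; first exact: integrableZl.
  move=> t /set_mem /= tuv; rewrite lee_fin -mulrA.
  apply: le_trans (gram_form_CauchySchwarz _ _ sA) _.
  have [it wK] := hK t tuv.
  have [ht _] := Dh t (uvD t tuv).
  rewrite (speed_chart g ht it (C1X t tuv)).
  by apply: ler_wpM2l; [exact: gram_norm_ge0|exact: wK].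
have ftc : (\int[mu]_(t in `[u, v]) (f' t)%:E = (f v)%:E - (f u)%:E)%E.
  apply: continuous_FTC2 => //.
    by apply: within_derivable_oo_LRcontinuous => // t /df[].
  by move=> t tuv; apply: (df t _).2; exact: subset_itv_oo_cc.
rewrite {}ftc -EFinB lee_fin /f -gram_formBr -[in leLHS]/w -sqr_gram_norm// expr2 -mulrA.
have := gram_norm_ge0 A w; rewrite le_eqVlt => /predU1P[<- _|w0].
  rewrite mulr_ge0 ?(ltW K0)// -lee_fin.
  exact: le_trans (curve_length_ge0 g _ _ _) hl.
by rewrite ler_pM2l.
Qed.

(** The coordinates ball *)
(** Around [x0] the metric is that of a flat space up to the factor [K]. *)
Definition comparable_ball (i : atlas_index M) (x0 : 'rV[R]_n) (K r : R) : Prop :=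
  [/\ 0 < r, 1 < K, spd (g i x0) &
    forall x, gram_norm (g i x0) (x - x0) < r -> ccod (atlas i) x /\
      forall w, gram_norm (g i x0) w <= K * gram_norm (g i x) w /\
                gram_norm (g i x) w <= K * gram_norm (g i x0) w].

Lemma comparable_ball_exists i x0 K : 1 < K -> ccod (atlas i) x0 ->
  exists r, comparable_ball i x0 K r.
Proof.
move=> K1 ix0; have sA := gram_spd g ix0.
have cg : g i x @[x --> x0] --> g i x0 by exact: (gram_smooth g i 0%N).
have nK := gram_norm_near_comparable (nbhs_filter x0) K1 sA cg.
have ni : \forall x \near x0, ccod (atlas i) x.
  by apply: open_nbhs_nbhs; split => //; exact: ccod_open.
have [c c0 cN] := gram_norm_coercive sA.
have [d /= d0 dP] := (nbhs_ballP _ _).1 (filterI ni nK).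
exists (c * d); split => //; first exact: mulr_gt0.
move=> x xr; have [] // := dP x.
rewrite -ball_normE /ball_ /= distrC -(ltr_pM2l c0).
exact: le_lt_trans (cN _) xr.
Qed.

Section exit.
Variables (i : atlas_index M) (x0 : 'rV[R]_n) (K r : R).
Hypothesis Br : comparable_ball i x0 K r.
Let A := g i x0.
Let x_ := cmap (atlas i).
Let B : set M := [set p | cdom (atlas i) p /\ gram_norm A (x_ p - x0) < r].

Let sA : spd A. Proof. by case: Br. Qed.
Let K0 : 0 < K. Proof. by case: Br => _ K1 _ _; exact: lt_trans K1. Qed.

Let B_comparable p : B p -> cdom (atlas i) p /\
  forall w, gram_norm A w <= K * gram_norm (g i (x_ p)) w.
Proof.
case=> ip pr; split=> // w; case: Br => _ _ _ /(_ _ pr)[_ /(_ w)[]//].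
Qed.

Let near_B h t : {for t, continuous h} -> B (h t) -> \forall s \near t, B (h s).
Proof.
move=> ch [it rt]; apply: filterI; first exact: near_cdom.
have : {for t, continuous (fun s => gram_norm A (x_ (h s) - x0))}.
  have cx := cvg_comp _ _ ch (cmap_continuous it).
  exact: (cvg_comp _ _ cx (@gram_norm_sub_continuous _ _ A x0 _)).
by move=> /cvgr_lt; exact.
Qed.

(** Otherwise let m be the last time outside the ball B.  After m the curve stays
    in B, so by [displacement_le_length] it stays in the closed ball of radius
    r' < r.  The image C of that ball in M is compact, hence closed as M is
    Hausdorff, and so contains h m as a limit of h s for s > m; but C lies
    in B. *)
Lemma no_exit_piece (D : set R) h u v l :
  open D -> C1_curve D h -> u <= v -> `[u, v] `<=` D ->
  B (h v) -> (curve_length g u v h <= l%:E)%E ->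
  gram_norm A (x_ (h v) - x0) + K * l < r ->
  forall t, t \in `[u, v] -> B (h t).
Proof.
move=> oD Dh uv uvD Bv hl lr.
have ch t : t \in `[u, v] -> {for t, continuous h}.
  by move=> tuv; case: (Dh t (uvD t tuv)).
apply: contrapT => noB.
pose E : set R := [set t | t \in `[u, v] /\ ~ B (h t)].
have E0 : E !=set0.
  apply: contrapT => nE; apply: noB => t tuv; apply: contrapT => nB.
  by apply: nE; exists t.
have cE : compact E.
  apply: (subclosed_compact _ (@segment_compact R u v)); last by move=> t [].
  rewrite -openC openE => t /= nE.
  have [tuv|tuv] := boolP (t \in `[u, v]).
    have Bt : B (h t) by apply: contrapT => nB; exact: nE.
    by apply: filterS (near_B (ch t tuv) Bt) => s Bs [_].
  have : nbhs t (~` `[u, v]%classic).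
    apply: open_nbhs_nbhs; split; last exact/negP.
    by rewrite openC; exact: interval_closed.
  by apply: filterS => s suv [].
have [m /set_mem [muv nBm] mmax] :=
  compact_EVT_max E0 cE (continuous_subspaceT (fun x : R => @cvg_id _ (nbhs x))).
have [um mv] : u <= m /\ m < v.
  move: (muv); rewrite in_itv /= => /andP[um mv]; split=> //.
  rewrite lt_neqAle mv andbT; apply/eqP => E'; apply: nBm; rewrite E'; exact: Bv.
have Bafter s : m < s -> s <= v -> B (h s).
  move=> ms sv; apply: contrapT => nB.
  have /mmax : s \in E by rewrite inE; split => //; rewrite in_itv /= sv andbT; lra.
  by rewrite leNgt ms.
pose r' := gram_norm A (x_ (h v) - x0) + K * l.
pose C := cinv (atlas i) @` [set x | gram_norm A (x - x0) <= r'].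
have inB x : gram_norm A (x - x0) <= r' -> ccod (atlas i) x.
  by move=> xr; case: Br => _ _ _ /(_ x (le_lt_trans xr lr))[].
have closedC : closed C.
  apply: compact_closed; first exact: carrier_hausdorff.
  apply: continuous_compact; last exact: compact_gram_ball.
  by apply: continuous_in_subspaceT => x /set_mem /= /inB; exact: cinv_continuous.
have Cafter s : m < s -> s <= v -> C (h s).
  move=> ms sv; have [is_ _] := Bafter s ms sv.
  exists (x_ (h s)); last exact: cmapK.
  apply: le_trans (ler_dist_gram_norm _ (x_ (h v)) _ sA) _.
  rewrite addrC lerD2l gram_norm_sub//.
  have svuv : `[s, v] `<=` `[u, v].
    by apply: subset_itvr; rewrite bnd_simp; lra.
  apply: (@displacement_le_length A K i D h s v) => //.
  - exact: subset_trans svuv uvD.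
  - move=> t; rewrite in_itv /= => /andP[st tv]; apply: B_comparable.
    by apply: Bafter => //; exact: lt_le_trans st.
  - apply: le_trans hl; apply: ge0_subset_integral => //.
      exact: measurable_int (speed_integrable g oD Dh uvD).
    by move=> t _; rewrite lee_fin speed_ge0.
have [x xr' xm] : C (h m).
  apply: (@closed_cvg _ _ m^'+ _ h C closedC); last first.
    by apply: cvg_at_right_filter; exact: ch.
  near=> s; apply: Cafter; near: s; first exact: nbhs_right_gt.
  exact: nbhs_right_le.
apply: nBm; rewrite -xm; split; first exact/cinv_dom/inB.
by rewrite /x_ cinvK; [exact: le_lt_trans lr|exact: inB].
Unshelve. all: by end_near. Qed.

(** Pieces are added backwards from the end point [b], each of them spending part
    of the budget [l]. *)
Lemma no_exit_curve b c a l : piecewise_C1 a b c ->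
  B (c b) -> (curve_length g a b c <= l%:E)%E ->
  gram_norm A (x_ (c b) - x0) + K * l < r ->
  cdom (atlas i) (c a) /\ gram_norm A (x_ (c b) - x_ (c a)) <= K * l.
Proof.
move=> pc Bb hl lr; suff [[]//] : B (c a) /\ gram_norm A (x_ (c b) - x_ (c a)) <= K * l.
move: a pc l hl lr; apply: piecewise_C1_rect.
  move=> l hl _; split => //; rewrite subrr gram_norm0 mulr_ge0 ?(ltW K0)//.
  by rewrite -lee_fin (le_trans (curve_length_ge0 g _ _ _) hl).
move=> u v uv vb pc pcb IH l + lr.
have mub := measurable_speed_cons g uv vb pc pcb.
rewrite (curve_length_split (ltW uv) vb mub).
have [e [h [e0 Dh ch]]] := pc.
have oD := @open_widen R u v e; have uvD := @subset_widen R u v e e0.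
have mh : measurable_fun `[u, v] (speed g h).
  by have /measurable_int/measurable_EFinP := speed_integrable g oD Dh uvD.
rewrite (curve_length_piece (measurable_speed_piece g pc) mh ch).
move=> /(adde_le_fin (curve_length_ge0 g u v h) (curve_length_ge0 g v b c)).
move=> [l1 [l2 [uvl vbl]]]; rewrite !lee_fin => l10 l20 l12.
have Kl : K * l1 + K * l2 <= K * l by rewrite -mulrDr ler_wpM2l// ltW.
have Kl1 : 0 <= K * l1 by rewrite mulr_ge0// ltW.
have Kl2 : 0 <= K * l2 by rewrite mulr_ge0// ltW.
have [|Bv vbl2] := IH l2 vbl; first by apply: le_lt_trans lr; lra.
have cu : c u = h u by apply: ch; rewrite in_itv /= lexx ltW.
have cv : c v = h v by apply: ch; rewrite in_itv /= lexx ltW.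
have Bh : forall t, t \in `[u, v] -> B (h t).
  apply: (@no_exit_piece _ h u v l1 oD Dh (ltW uv) uvD); rewrite -?cv//.
  have := ler_dist_gram_norm (x_ (c v)) (x_ (c b)) x0 sA.
  rewrite (gram_norm_sub (x_ (c v)) (x_ (c b)) sA); lra.
split; first by rewrite cu; apply: Bh; rewrite in_itv /= lexx ltW.
have : gram_norm A (x_ (c v) - x_ (c u)) <= K * l1.
  rewrite cu cv; apply: displacement_le_length oD Dh (ltW uv) uvD _ _ => //.
  by move=> t /Bh/B_comparable.
have := ler_dist_gram_norm (x_ (c b)) (x_ (c v)) (x_ (c u)) sA; lra.
Qed.

(** The end point [q] of the curves is the one known to be in the chart; that [p]
    is in it too is part of the conclusion. *)
Lemma coord_dist_le p q l : cdom (atlas i) q ->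
  (riemannian_dist g p q < l%:E)%E ->
  gram_norm A (x_ q - x0) + K * l < r ->
  cdom (atlas i) p /\ gram_norm A (x_ q - x_ p) <= K * l.
Proof.
move=> iq /ereal_inf_lt[_ [a [b [c [pc <- cq ->]]]]] cl lr; subst q.
apply: (no_exit_curve pc _ (ltW cl) lr); split=> //.
apply: le_lt_trans lr; rewrite lerDl mulr_ge0 ?(ltW K0)//.
by rewrite -lee_fin (le_trans (curve_length_ge0 g a b c)) ?ltW.
Qed.

(** The coordinate segment from [x] to [y] is a competitor in the definition of the
    distance.  It must be C^1 on an open interval containing [0, 1]: with radius
    r / 5, the points x + t (y - x) with |t| < 2 are still at distance less than
    r / 5 + 2 (2 r / 5) = r from x0. *)
Lemma dist_le_coord x y :
  gram_norm A (x - x0) < r / 5 -> gram_norm A (y - x0) < r / 5 ->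
  (riemannian_dist g (cinv (atlas i) x) (cinv (atlas i) y)
    <= (K * gram_norm A (y - x))%:E)%E.
Proof.
move=> xr yr; pose line t := x + t *: (y - x); pose c := cinv (atlas i) \o line.
have inr t : t \in `]0 - 1, 1 + 1[ -> gram_norm A (line t - x0) < r.
  rewrite in_itv /= => /andP[t1 t2].
  have -> : line t - x0 = (x - x0) + t *: (y - x) by rewrite /line addrAC.
  apply: le_lt_trans (ler_gram_normD _ _ sA) _; rewrite gram_normZ//.
  have yx : gram_norm A (y - x) < 2 * (r / 5).
    have := ler_dist_gram_norm y x0 x sA; rewrite (gram_norm_sub x0 x sA); lra.
  have t2' : `|t| <= 2 by rewrite ler_norml; apply/andP; split; lra.
  have := ler_wpM2r (gram_norm_ge0 A (y - x)) t2'; lra.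
have cod t : t \in `]0 - 1, 1 + 1[ -> ccod (atlas i) (line t).
  by move=> /inr tr; case: Br => _ _ _ /(_ _ tr)[].
have dline t : derivable line t 1 /\ (line^`())%classic t = y - x.
  have h : is_derive t 1 line (y - x).
    apply: is_derive_eq; last exact: add0r. 
    apply: is_deriveD.
    apply: DeriveDef.
      apply/derivable1_diffP; exact: differentiableZl.
    by rewrite deriveE// diffZl// diff_val /= scale1r.
  by split; [exact: ex_derive|rewrite derive1E; exact: derive_val].
have C1line t : C1_near line t.
  split; first by apply: filterE => s; case: (dline s).
  rewrite (_ : (line^`())%classic = cst (y - x)); first exact: cvg_cst.
  by apply/funext => s; case: (dline s).
have oD : open (`]0 - 1, 1 + 1[%classic : set R) by exact: (@open_widen R).
have cc t : t \in `]0 - 1, 1 + 1[ -> {for t, continuous c}.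
  move=> tD; apply: continuous_comp; first exact: C1_near_continuous.
  by apply: cinv_continuous; exact: cod.
have lineE t : t \in `]0 - 1, 1 + 1[ -> {near t, line =1 cmap (atlas i) \o c}.
  move=> tD; have : \forall s \near t, s \in `]0 - 1, 1 + 1[.
    by apply: open_nbhs_nbhs; split.
  by apply: filterS => s /cod is_; rewrite /= cinvK.
have C1c t : t \in `]0 - 1, 1 + 1[ -> C1_near (cmap (atlas i) \o c) t.
  by move=> tD; apply: near_eq_C1_near (lineE t tD) (C1line t).
have ic t : t \in `]0 - 1, 1 + 1[ -> cdom (atlas i) (c t).
  by move=> /cod; exact: cinv_dom.
have Dc : C1_curve `]0 - 1, 1 + 1[ c.
  move=> t tD; split; first exact: cc.
  move=> j jt; have [C1j _] := C1_near_local_expr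
    (@smooth_map_id _ _ M) (cc t tD) (ic t tD) jt (C1c t tD).
  by split; [exact: C1_near_derivable C1j|case: C1j].
have pc : piecewise_C1 0 1 c.
  (* One piece, extended by e = 1 on both sides. *)
  exists [:: 1]; first exact: itv_partition1.
  by case=> //= _; exists 1, c; split.
have uvD : (`[0, 1] : set R) `<=` `]0 - 1, 1 + 1[ by exact: (@subset_widen R).
apply: (@le_trans _ _ (curve_length g 0 1 c)).
  apply: ereal_inf_lbound; exists 0, 1, c; split => //.
    by rewrite /c /line /= scale0r addr0.
  by rewrite /c /line /= scale1r addrC subrK.
have : (curve_length g 0 1 c <=
        \int[mu]_(t in `[0%R, 1%R]) (cst (K * gram_norm A (y - x))%:E t))%E.
  apply: ge0_le_integral; [by []| | | |].
  - by move=> t _; rewrite lee_fin speed_ge0.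
  - exact: measurable_int (speed_integrable g oD Dc uvD).
  - exact: measurable_cst.
  - move=> t /uvD tD; rewrite lee_fin (@speed_chart _ _ _ _ i)//; last 3 first.
    + exact: cc.
    + exact: ic.
    + exact: C1c.
    rewrite -(near_eq_derive1 (lineE t tD)) (dline t).2 /c /= cinvK; last exact: cod.
    by case: Br => _ _ _ /(_ _ (inr t tD))[_ /(_ (y - x))[]].
move=> /le_trans; apply.
have mu01 : mu `[0%R, 1%R]%classic = 1%E.
  by rewrite lebesgue_measure_itv /= lte_fin ltr01 -EFinB subr0.
have := integral_cst mu (measurable_itv `[0%R, 1%R]) (K * gram_norm A (y - x))%:E.
rewrite [X in (_ * X)%E]mu01 mule1 => ->.
exact: lexx.
Qed.

End exit.
End distance.

(** * Limits of isometries *)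

Section C0_limit.
Variables (R : realType) (n : nat) (M : smooth_manifold R n).
Variable g : riemannian_metric M.

Lemma C0_cvg_dist (psi_ : nat -> M -> M) psi l : C0_cvg g psi_ psi -> 0 < l ->
  exists k, forall p, (riemannian_dist g (psi_ k p) (psi p) < l%:E)%E.
Proof.
move=> cpsi l0.
have : \forall k \near \oo,
    (ereal_sup [set riemannian_dist g (psi_ k x) (psi x) | x in [set: M]] < l%:E)%E.
  apply: (cpsi [set y | (y < l%:E)%E]); apply: open_nbhs_nbhs; split.
    exact: open_ereal_lt_ereal.
  by rewrite /= lte_fin.
move=> [k _ /(_ k (leqnn k)) /= kl]; exists k => p.
by apply: le_lt_trans kl; apply: ereal_sup_ubound; exists p.
Qed.

Variables (psi_ : nat -> M -> M) (psi : M -> M).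
Hypothesis psi_Iso : forall k, Iso g (psi_ k).
Hypothesis psi_cvg : C0_cvg g psi_ psi.
Variables (i j : atlas_index M) (x0 : 'rV[R]_n) (K r r' : R).
Let F := local_expr psi i j.
Let p := cinv (atlas i) x0.
Hypothesis ix0 : ccod (atlas i) x0.
Hypothesis jp : cdom (atlas j) (psi p).
Hypothesis Br : comparable_ball g i x0 K r.
Hypothesis Br' : comparable_ball g j (F x0) K r'.
Let N := gram_norm (g i x0).
Let N' := gram_norm (g j (F x0)).

(** Replacing psi by psi_k moves the two image points by at most eta in
    coordinates, and d(psi_k p', psi_k p) = d(p', p).  For the first inequality
    d(p', p) is bounded above by K N(x - x0) and d(psi_k p', psi_k p) below in
    the target chart; for the second one the roles are exchanged.  The
    hypotheses on the size of the increments keep all points in the balls where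
    the comparison of d with the norms is valid. *)
Lemma limit_biLipschitz x :
  ccod (atlas i) x -> cdom (atlas j) (psi (cinv (atlas i) x)) ->
  N (x - x0) < r / 5 -> K * (K * N (x - x0)) < r' / 2 ->
  N' (F x - F x0) < r' / 10 -> K * (K * N' (F x - F x0)) < r / 2 ->
  N' (F x - F x0) <= K ^+ 2 * N (x - x0) /\
  N (x - x0) <= K ^+ 2 * N' (F x - F x0).
Proof.
move=> ix jx xr xr' Fr' Fr.
have [r0 K1 sA _] := Br; have [r'0 _ sA' _] := Br'.
have K0 : 0 < K by exact: lt_trans K1.
pose p' := cinv (atlas i) x.
set s := N (x - x0) in xr xr' *; set S := N' (F x - F x0) in Fr' Fr *.
suff H e : 0 < e -> S <= K ^+ 2 * s + e /\ s <= K ^+ 2 * S + e.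
  by split; apply/ler_addgt0Pr => e /H[].
move=> e0; pose C := 2 * K ^+ 2 + 1.
have K2 : 1 < K ^+ 2 by rewrite exprn_egt1.
have [th [th0 thr' thr the]] :
    exists th, [/\ 0 < th, th < r' / 10, th < r / 2 & th <= e].
  (* th bounds the total error; the displacement eta = th / C of the image
     points is such that the errors 3 eta and (2 K^2 + 1) eta = th of the two
     inequalities do not exceed it, and psi_k is d = eta / K close to psi. *)
  exists (Num.min (Num.min (r' / 20) (r / 4)) e).
  have r'10 : r' / 20 < r' / 10 by lra.
  have r2 : r / 4 < r / 2 by lra.
  by split; rewrite ?lt_min ?gt_min ?ge_min ?r'10 ?r2 ?lexx ?orbT ?e0 ?divr_gt0.
pose eta := th / C; pose d := eta / K.
have C3 : 3 < C by rewrite /C; lra.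
have C0 : 0 < C by lra.
have eta0 : 0 < eta by rewrite divr_gt0.
have Ceta : 2 * K ^+ 2 * eta + eta = th.
  by rewrite /eta /C; field; rewrite gt_eqF.
have eta3 : 3 * eta < th by rewrite -Ceta; have := ltr_pM2r eta0 1 (K ^+ 2); rewrite K2; lra.
have d0 : 0 < d by rewrite divr_gt0.
have Kd : K * d = eta by rewrite /d mulrC divfK// gt_eqF.
have [k kd] := C0_cvg_dist psi_cvg d0.
have F0 : cmap (atlas j) (psi p) = F x0 by [].
have Fx : cmap (atlas j) (psi p') = F x by [].
have [jkx Dx] : cdom (atlas j) (psi_ k p') /\
    N' (F x - cmap (atlas j) (psi_ k p')) <= eta.
  rewrite -Kd -Fx; apply: (coord_dist_le Br' jx (kd p')).
  by rewrite Kd -/p' Fx -/N' -/S; lra.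
have [jk0 D0] : cdom (atlas j) (psi_ k p) /\
    N' (F x0 - cmap (atlas j) (psi_ k p)) <= eta.
  rewrite -Kd -{1}F0; apply: (coord_dist_le Br' jp (kd p)).
  by rewrite Kd F0 subrr gram_norm0; lra.
set yx := cmap (atlas j) (psi_ k p') in Dx *.
set y0 := cmap (atlas j) (psi_ k p) in D0 *.
have D0' : N' (y0 - F x0) <= eta by rewrite /N' gram_norm_sub.
have Dx' : N' (yx - F x) <= eta by rewrite /N' gram_norm_sub.
have isoE := riemannian_dist_isometry p' p (psi_Iso k).
have s_sub : N (x0 - x) = s by rewrite /N gram_norm_sub.
have N00 : N (x0 - x0) < r / 5 by rewrite subrr /N gram_norm0; lra.
split.
- have dk : (riemannian_dist g (psi_ k p') (psi_ k p) < (K * s + d)%:E)%E.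
    rewrite isoE; apply: (@le_lt_trans _ _ (K * s)%:E); last by rewrite lte_fin; lra.
    by have := dist_le_coord Br xr N00; rewrite -/N s_sub.
  have [|_] := coord_dist_le Br' jk0 dk.
    by rewrite -/y0 -/N' mulrDr Kd; lra.
  rewrite -/y0 -/yx -/N' mulrDr Kd mulrA -expr2 => Dk.
  have := ler_dist_gram_norm (F x) yx (F x0) sA'.
  have := ler_dist_gram_norm yx y0 (F x0) sA'.
  rewrite -!/N' (_ : N' (yx - y0) = N' (y0 - yx)); last by rewrite /N' gram_norm_sub.
  rewrite -/S; lra.
- have yxr : N' (yx - F x0) < r' / 5.
    by have := ler_dist_gram_norm yx (F x) (F x0) sA'; rewrite -!/N' -/S; lra.
  have y0r : N' (y0 - F x0) < r' / 5 by lra.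
  have y0x : N' (y0 - yx) <= S + 2 * eta.
    have := ler_dist_gram_norm y0 (F x0) yx sA'.
    have := ler_dist_gram_norm (F x0) (F x) yx sA'.
    rewrite -!/N' (_ : N' (F x0 - F x) = S); last by rewrite /N' gram_norm_sub.
    lra.
  have dk : (riemannian_dist g p' p < (K * (S + 2 * eta) + d)%:E)%E.
    rewrite -isoE; apply: (@le_lt_trans _ _ (K * (S + 2 * eta))%:E); last first.
      by rewrite lte_fin; lra.
    have := dist_le_coord Br' yxr y0r; rewrite !cmapK// => /le_trans; apply.
    by rewrite lee_fin ler_wpM2l// ltW.
  have E : K * (K * (S + 2 * eta) + d) = K ^+ 2 * S + th.
    by rewrite mulrDr Kd -Ceta; ring.
  have [|_] := coord_dist_le Br (cinv_dom ix0) dk.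
    by rewrite cinvK// E subrr gram_norm0 add0r; move: Fr; rewrite mulrA -expr2; lra.
  rewrite !cinvK// -/N s_sub E; lra.
Qed.

End C0_limit.

Section main.
Variables (R : realType) (n : nat) (M : smooth_manifold R n).
Variable g : riemannian_metric M.
Variables (psi_ : nat -> M -> M) (psi : M -> M).
Hypothesis psi_Iso : forall k, Iso g (psi_ k).
Hypothesis psi_cvg : C0_cvg g psi_ psi.
Hypothesis psi_smooth : smooth_map psi.

(** All the smallness conditions of [limit_biLipschitz] hold near x0, by continuity
    of the increments at x0. *)
Lemma limit_near_isometric (i j : atlas_index M) x0 K : 1 < K ->
  ccod (atlas i) x0 -> cdom (atlas j) (psi (cinv (atlas i) x0)) ->
  let F := local_expr psi i j in
  \forall x \near x0,
    gram_norm (g j (F x0)) (F x - F x0) <= K ^+ 2 * gram_norm (g i x0) (x - x0) /\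
    gram_norm (g i x0) (x - x0) <= K ^+ 2 * gram_norm (g j (F x0)) (F x - F x0).
Proof.
move=> K1 ix0 jx0 F.
have jF0 : ccod (atlas j) (F x0) by exact: cmap_cod.
have [r Br] := comparable_ball_exists g K1 ix0.
have [r' Br'] := comparable_ball_exists g K1 jF0.
have [r0 _ sA _] := Br; have [r'0 _ sA' _] := Br'.
have [cpsi spsi] := psi_smooth.
pose U := ccod (atlas i) `&` (psi \o cinv (atlas i)) @^-1` cdom (atlas j).
have oU : open U by exact: open_cinv_preimage cpsi (@cdom_open _ _ _ _).
have nU : \forall x \near x0, U x by apply: open_nbhs_nbhs.
have cF : {for x0, continuous F} by apply: (spsi i j 0%N).
pose N x := gram_norm (g i x0) (x - x0).
pose N' x := gram_norm (g j (F x0)) (F x - F x0).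
have cN : N x @[x --> x0] --> 0.
  by rewrite -[X in _ --> X](gram_norm0 (g i x0)) -[in X in _ --> X](subrr x0);
     exact: gram_norm_sub_continuous.
have cN' : N' x @[x --> x0] --> 0.
  rewrite -[X in _ --> X](gram_norm0 (g j (F x0))) -[in X in _ --> X](subrr (F x0)).
  exact: (cvg_comp _ _ cF (@gram_norm_sub_continuous _ _ _ (F x0) _)).
have cKN : K * (K * N x) @[x --> x0] --> 0.
  have := cvgM (cvg_cst K) (cvgM (cvg_cst K) cN); rewrite !mulr0; exact.
have cKN' : K * (K * N' x) @[x --> x0] --> 0.
  have := cvgM (cvg_cst K) (cvgM (cvg_cst K) cN'); rewrite !mulr0; exact.
near=> x; apply: (limit_biLipschitz psi_Iso psi_cvg ix0 jx0 Br Br').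
- by have [] : U x by near: x.
- by have [] : U x by near: x.
- by near: x; apply: (cvgr_lt _ cN); rewrite divr_gt0.
- by near: x; apply: (cvgr_lt _ cKN); rewrite divr_gt0.
- by near: x; apply: (cvgr_lt _ cN'); rewrite divr_gt0.
- by near: x; apply: (cvgr_lt _ cKN'); rewrite divr_gt0.
Unshelve. all: by end_near. Qed.

(** Both Gram matrices have the same quadratic form: the factor K^2 in the
    comparison of the norms of v and of its image tends to 1. *)
Lemma limit_pullback i x : ccod (atlas i) x -> pullback g psi i x = g i x.
Proof.
move=> ix; rewrite /pullback; set j := chart_at _; set F := local_expr psi i j.
have jx : cdom (atlas j) (psi (cinv (atlas i) x)) by exact: chart_atP.
have sA := gram_spd g ix.
have sA' : spd (g j (F x)) by apply: gram_spd; exact: cmap_cod.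
have dF : differentiable F x by have [_ /(_ i j 1%N)[+ _]] := psi_smooth; exact.
apply: gram_form_inj; first by rewrite !trmx_mul trmxK mulmxA; case: sA' => ->.
  by case: sA.
move=> v; rewrite -gram_form_mulmx -!sqr_gram_norm//; congr (_ ^+ 2).
apply/le_anti/andP; split; apply: ler_sqr_factor (gram_norm_ge0 _ _) _ => K K1.
  apply: gram_norm_jacobian_le => //.
  by apply: filterS (limit_near_isometric K1 ix jx) => y [].
apply: gram_norm_jacobian_ge => //.
by apply: filterS (limit_near_isometric K1 ix jx) => y [].
Qed.

End main.

Theorem theorem7 (R : realType) (n : nat) (M : smooth_manifold R n)
    (g : riemannian_metric M) (M_compact : compact [set: M])
    (M_connected : connected [set: M])
    (psi_ : nat -> M -> M) (psi : M -> M)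
    (psi_Diff : Diff M psi) (psi_Iso : forall k, Iso g (psi_ k))
    (psi_cvg : C0_cvg g psi_ psi) :
  Iso g psi.
Proof.
split=> // i x; have [psi_smooth _] := psi_Diff.
exact: (limit_pullback psi_Iso psi_cvg psi_smooth).
Qed.
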